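(* Let $\lambda>0$, let $f$ be a finite DC function on $\mathbb{R}^n\times\mathbb{R}^m$, and let $K\subset\mathbb{R}^n\times\mathbb{R}^m$ be a convex set with $K\subset\prod_{i=1}^n[a_i,b_i]\times\mathbb{R}^m$, where $a_i,b_i\in\mathbb{R}$, $a_i\le0<b_i$ for $i=1,\dots,n$. Let $c_i=\max\{|a_i|,|b_i|\}$ and $M=\max\{c_i:i=1,\dots,n\}$. For $\tau>0$ put $\theta:=\frac{\tau+\lambda}{\lambda M}$, $\pi(t):=t+\frac{\tau}{\lambda}\min\{t,1-t\}$ and $r_{cap}(t):=\min\{\theta|t|,1\}$ for $t\in\mathbb{R}$, and consider the problems $$(A)\qquad \alpha(\tau):=\inf\Big\{f(x,y)+\lambda\sum_{i=1}^n\pi(u_i):(x,y)\in K,\ \frac{|x_i|}{M}\le u_i\le1,\ i=1,\dots,n\Big\},$$ $$(B)\qquad \beta(\theta):=\inf\Big\{f(x,y)+\lambda\sum_{i=1}^n r_{cap}(x_i):(x,y)\in K\Big\}.$$ Then for all $\tau\ge\lambda$ problems (A) and (B) are equivalent in the following sense: $(x^*,y^* )$ is an optimal solution of (B) if and only if $(x^*,y^*,u^* )$ is an optimal solution of (A), where $u_i^*\in\left\{\frac{|x_i^*|}{M},1\right\}$ is such that $\pi(u_i^* )=r_{cap}(x_i^* )$ for $i=1,\dots,n$. Moreover, $\alpha(\tau)=\beta(\theta)$.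
   Context: A finite DC function is a difference $g-h$ of two finite convex functions. *)

(* Defs.v *)
(* Library: Mathematical Components with MathComp-Analysis. *)
From mathcomp Require Import all_boot all_order all_algebra.
From mathcomp Require Import all_classical all_reals.
From mathcomp Require Import ereal convex.

Set Implicit Arguments.
Unset Strict Implicit.
Unset Printing Implicit Defensive.

Import Order.TTheory GRing.Theory Num.Theory.
Local Open Scope classical_set_scope.
Local Open Scope ring_scope.

(* Finiteness of the functions is carried by the codomain R. *)
Definition dc_function (R : realType) (E : lmodType R) (f : E -> R) : Prop :=
  exists g h : E -> R,
    [/\ convex_function (E := E) setT g,
        convex_function (E := E) setT h &
        forall z, f z = g z - h z].

(* The problem inf {F z : z \in S}; its value is +oo when S is empty and -oo
   when F is unbounded below on S. *)
Definition opt_value (R : realType) (T : Type) (S : set T) (F : T -> R) :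
    \bar R :=
  ereal_inf [set (F z)%:E | z in S].

Definition optimal_solution (R : realType) (T : Type) (S : set T) (F : T -> R)
    (z : T) : Prop :=
  S z /\ forall w, S w -> F z <= F w.

Section Problems.
Context {R : realType} {n m : nat}.

Definition box (a b : 'I_n -> R) : set 'rV[R]_n :=
  [set x : 'rV[R]_n | forall i, a i <= x ord0 i <= b i].

(* The default value 0 is harmless when 0 < n, all the terms being
   nonnegative. *)
Definition bigM (a b : 'I_n -> R) : R :=
  \big[Num.max/0]_(i < n) Num.max `|a i| `|b i|.

Definition theta (lambda tau M : R) : R := (tau + lambda) / (lambda * M).

Definition pi_pen (lambda tau t : R) : R :=
  t + tau / lambda * Num.min t (1 - t).

Definition r_cap (th t : R) : R := Num.min (th * `|t|) 1.

Implicit Types (K : set ('rV[R]_n * 'rV[R]_m)) (f : 'rV[R]_n * 'rV[R]_m -> R).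

Definition feasibleA K (M : R) : set ('rV[R]_n * 'rV[R]_m * 'rV[R]_n) :=
  [set z : 'rV[R]_n * 'rV[R]_m * 'rV[R]_n |
    K z.1 /\ forall i, `|z.1.1 ord0 i| / M <= z.2 ord0 i <= 1].

Definition objectiveA f (lambda tau : R)
    (z : 'rV[R]_n * 'rV[R]_m * 'rV[R]_n) : R :=
  f z.1 + lambda * \sum_(i < n) pi_pen lambda tau (z.2 ord0 i).

Definition objectiveB f (lambda th : R) (z : 'rV[R]_n * 'rV[R]_m) : R :=
  f z + lambda * \sum_(i < n) r_cap th (z.1 ord0 i).

Definition alpha K f (lambda M tau : R) : \bar R :=
  opt_value (feasibleA K M) (objectiveA f lambda tau).

Definition beta K f (lambda th : R) : \bar R :=
  opt_value K (objectiveB f lambda th).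

Definition associated (lambda tau M : R) (x u : 'rV[R]_n) : Prop :=
  forall i,
    (u ord0 i = `|x ord0 i| / M \/ u ord0 i = 1) /\
    pi_pen lambda tau (u ord0 i) = r_cap (theta lambda tau M) (x ord0 i).

End Problems.

(* Main.v *)
(* With s = |x_i| / M in [0, 1] and k = tau / lambda >= 1 one has
   pi(u) = min ((1 + k) u) (u + k (1 - u)) and r_cap(x_i) = min ((1 + k) s) 1.
   Since u + k (1 - u) >= 1 for u <= 1, pi(u) >= r_cap(x_i) on [s, 1], with
   equality at u = s or at u = 1.  Hence (B) is (A) partially minimised over u,
   for fixed (x, y). *)
Require Import Defs.
From mathcomp Require Import all_boot all_order all_algebra.
From mathcomp Require Import all_classical all_reals.
From mathcomp Require Import ereal convex.
From mathcomp Require Import ring lra.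

Import Order.TTheory GRing.Theory Num.Theory.
Local Open Scope classical_set_scope.
Local Open Scope ring_scope.

Section PartialMinimisation.
Context {R : realType} {T U : Type} {S : set T} {S' : set U}.
Context {F : T -> R} {G : U -> R} {p : U -> T}.
(** Together the three hypotheses say that, for z in [S], [F z] is the attained minimum of [G] over
    the points of [S'] above z. *)
Hypothesis S'S : forall w, S' w -> S (p w).
Hypothesis FG : forall w, S' w -> F (p w) <= G w.
Hypothesis lift : forall z, S z -> exists w, [/\ S' w, p w = z & G w = F z].

Lemma opt_value_partial_min : opt_value S' G = opt_value S F.
Proof.
apply/eqP; rewrite eq_le; apply/andP; split; apply: le_ereal_inf_tmp => _ [z Sz <-].
- have [w [S'w _ <-]] := lift _ Sz.
  by apply: ereal_inf_lbound; exists w.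
- apply: (@le_trans _ _ (F (p z))%:E); last by rewrite lee_fin; exact: FG.
  by apply: ereal_inf_lbound; exists (p z) => //; exact: S'S.
Qed.

(** Feasibility of [w] is only asked given that of [p w], since each direction starts from a point
    feasible for its own problem. *)
Lemma optimal_solution_partial_min {w} : (S (p w) -> S' w) -> G w = F (p w) ->
  optimal_solution S F (p w) <-> optimal_solution S' G w.
Proof.
move=> SS' Gw; split=> -[Sw minw]; split.
- exact: SS'.
- by move=> v S'v; rewrite Gw (le_trans (minw _ (S'S _ S'v)))// FG.
- exact: S'S.
- by move=> z /lift[v [S'v _ <-]]; rewrite -Gw; exact: minw.
Qed.

End PartialMinimisation.

Section Penalty.
Context {R : realType} {lambda tau M : R}.
Hypotheses (lambda_gt0 : 0 < lambda) (M_gt0 : 0 < M) (le_tau : lambda <= tau).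

Let k_ge1 : 1 <= tau / lambda.
Proof. by rewrite ler_pdivlMr ?mul1r. Qed.

Lemma theta_mul t : theta lambda tau M * t = (1 + tau / lambda) * (t / M).
Proof. by rewrite /theta; field; rewrite !gt_eqF. Qed.

Lemma r_cap_le_pi_pen x u : `|x| / M <= u <= 1 ->
  r_cap (theta lambda tau M) x <= pi_pen lambda tau u.
Proof.
rewrite /r_cap /pi_pen theta_mul => /andP[].
move: (tau / lambda) k_ge1 (`|x| / M) => k k1 s su u1.
(* If the minimum is u, then (1 + k) s <= (1 + k) u; if it is 1 - u, then u + k (1 - u) - 1 = (k -
   1) (1 - u) >= 0. *)
rewrite ge_min; case: (leP u (1 - u)) => _; apply/orP; [left|right]; nra.
Qed.

Lemma pi_pen1 : pi_pen lambda tau 1 = 1.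
Proof. by rewrite /pi_pen subrr min_r ?ler01// mulr0 addr0. Qed.

Lemma pi_pen_eq_r_cap x : exists u, (u = `|x| / M \/ u = 1) /\
  pi_pen lambda tau u = r_cap (theta lambda tau M) x.
Proof.
rewrite /r_cap theta_mul.
(* The witness follows the active argument of [r_cap]: u = 1 on the cap, u = s below it. *)
have [le1|/ltW ge1] := leP ((1 + tau / lambda) * (`|x| / M)) 1; last first.
  by exists 1; split; [right | exact: pi_pen1].
exists (`|x| / M); split; first by left.
rewrite /pi_pen min_l; first by ring.
(* It remains to see s <= 1 - s, which holds as 2 s <= (1 + k) s <= 1. *)
have : 0 <= `|x| / M by rewrite divr_ge0 ?(ltW M_gt0).
move: (tau / lambda) k_ge1 (`|x| / M) le1 => k k1 s le1 s0; nra.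
Qed.

End Penalty.

Section Box.
Context {R : realType} {n : nat} {a b : 'I_n -> R}.

Lemma max_norm_le_bigM i : Num.max `|a i| `|b i| <= bigM a b.
Proof. exact: le_bigmax. Qed.

(** An index exists since 0 < n, so the maximum exceeds its default value 0 through some [b i]. *)
Lemma bigM_gt0 : (0 < n)%N -> (forall i, 0 < b i) -> 0 < bigM a b.
Proof.
move=> n0 b0; apply: lt_le_trans (max_norm_le_bigM (Ordinal n0)).
by rewrite lt_max !normr_gt0 (gt_eqF (b0 _)) orbT.
Qed.

Lemma box_norm_le_bigM x i : box a b x -> `|x ord0 i| <= bigM a b.
Proof.
move=> /(_ i) /andP[ax xb]; apply: le_trans (max_norm_le_bigM i).
(* A nonnegative coordinate is bounded by [b i], a negative one by [- a i] in absolute value. *)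
rewrite le_max; have [_|_] := ger0P (x ord0 i).
  by rewrite (le_trans xb (ler_norm _)) orbT.
by rewrite -[`|a i|]normrN (le_trans _ (ler_norm _))// lerN2.
Qed.

End Box.

Theorem proposition3 (R : realType) (n m : nat) (hn : (0 < n)%N)
    (lambda : R) (hlambda : 0 < lambda)
    (f : 'rV[R]_n * 'rV[R]_m -> R) (hf : dc_function f)
    (K : set ('rV[R]_n * 'rV[R]_m)) (hK : convex_set K)
    (a b : 'I_n -> R) (hab : forall i, a i <= 0 < b i)
    (hbox : K `<=` box a b `*` setT)
    (tau : R) (htau : lambda <= tau) :
  let M := bigM a b in
  let th := theta lambda tau M in
  (forall (x : 'rV[R]_n) (y : 'rV[R]_m),
     (exists u, associated lambda tau M x u) /\
     (forall u, associated lambda tau M x u ->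
        (optimal_solution K (objectiveB f lambda th) (x, y) <->
         optimal_solution (feasibleA K M) (objectiveA f lambda tau)
           (x, y, u)))) /\
  alpha K f lambda M tau = beta K f lambda th.
Proof.
move=> M th.
have M0 : 0 < M by apply: bigM_gt0 => // i; case/andP: (hab i).
have ex_assoc (x : 'rV_n) : exists u, associated lambda tau M x u.
  have [u hu] := choice (fun i =>
    pi_pen_eq_r_cap hlambda M0 htau (x ord0 i)).
  by exists (\row_i u i) => i; rewrite mxE.
(* The box gives s <= 1, so both candidates s and 1 lie in [s, 1]. *)
have feasible x y u : associated lambda tau M x u -> K (x, y) ->
    feasibleA K M (x, y, u).
  move=> xu Kxy; split=> //= i; have [xb _] := hbox _ Kxy.
  have s1 : `|x ord0 i| / M <= 1.
    by rewrite ler_pdivrMr// mul1r; exact: box_norm_le_bigM.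
  by have [[->|->] _] := xu i; rewrite ?lexx ?s1.
have obj_eq x y u : associated lambda tau M x u ->
    objectiveA f lambda tau (x, y, u) = objectiveB f lambda th (x, y).
  move=> xu; rewrite /objectiveA /objectiveB; congr (_ + _ * _).
  by apply: eq_bigr => i _; case: (xu i).
(* The partial minimisation is applied with [p] the projection forgetting u. *)
have S'S w : feasibleA K M w -> K w.1 by case.
have FG w : feasibleA K M w ->
    objectiveB f lambda th w.1 <= objectiveA f lambda tau w.
  move=> [_ w2]; rewrite lerD2l ler_pM2l//; apply: ler_sum => i _.
  exact: r_cap_le_pi_pen.
have lift z : K z -> exists w, [/\ feasibleA K M w, w.1 = z &
    objectiveA f lambda tau w = objectiveB f lambda th z].
  case: z => x y Kxy; have [u xu] := ex_assoc x.
  by exists (x, y, u); split; [exact: feasible | | exact: obj_eq].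
split; last exact: opt_value_partial_min S'S FG lift.
move=> x y; split=> // u xu.
apply: (optimal_solution_partial_min S'S FG lift (w := (x, y, u))).
- exact: feasible.
- exact: obj_eq.
Qed.
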